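(* Consider the online hiring problem under sequential employment with costs drawn i.i.d. from a known continuous distribution $X$ on $[0,\infty)$ with finite mean. For $m\ge 0$ let $\mathbf{E}_m$ be the minimum expected cost of an online algorithm for $m$ applicants under sequential employment ($\mathbf{E}_0=0$), let $\tau_m=\mathbf{E}_m/m$ for $m\ge 1$ and $\tau_0=+\infty$. The following online algorithm (Algorithm 5) is optimal, i.e., has expected cost $\mathbf{E}_n$: for $i=1,\dots,n$, if $x_i<\tau_{n-i}$, hire applicant $i$ for the remaining $n-i+1$ time steps and stop; otherwise hire applicant $i$ for one time step.
   Context: Online hiring problem: there are $n$ time steps; in time step $i$ applicant $i$ arrives and its cost $x_i$ is revealed, with $x_1,\dots,x_n$ drawn independently from $X$. Immediately and irrevocably at time $i$, based only on $x_1,\dots,x_i$ and earlier decisions, the algorithm chooses a nonnegative integer duration $t_i$; applicant $i$ is then under contract during time steps $i,\dots,i+t_i-1$; the cost is $\sum_i t_ix_i$. Under sequential employment, at every time step $s\in\{1,\dots,n\}$ exactly one applicant is under contract (contracts may not overlap and must cover all time steps). *)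

(* Defs.v *)
From HB Require Import structures.
From mathcomp Require Import all_boot all_order all_algebra.
From mathcomp Require Import all_classical all_reals all_analysis.

Set Implicit Arguments.
Unset Strict Implicit.
Unset Printing Implicit Defensive.

Import Order.TTheory GRing.Theory Num.Theory.
Import numFieldNormedType.Exports.

Local Open Scope classical_set_scope.
Local Open Scope ring_scope.

Section iid.
Context {R : realType}.

Definition pair_cons n (p : R * n.-tuple R) : n.+1.-tuple R :=
  [tuple of p.1 :: p.2].

Lemma measurable_pair_cons n : measurable_fun setT (@pair_cons n).
Proof. exact: measurable_cons. Qed.

HB.instance Definition _ n :=
  isMeasurableFun.Build _ _ _ _ (@pair_cons n) (@measurable_pair_cons n).

(* The n-fold product of mu on R^n, i.e. the joint law of n independent draws
   from mu. *)
Fixpoint iid (mu : probability R R) n : probability (n.-tuple R) R :=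
  match n with
  | 0 => dirac [tuple]
  | k.+1 => distribution (mu \x iid mu k)%E (@pair_cons k)
  end.

End iid.

(* Time steps and applicants are numbered from 0, so that with m applicants
   they range over 0, ..., m - 1. *)
Section hiring.
Context {R : realType}.

(* An algorithm maps the costs revealed so far (the current one last) and the
   durations chosen so far to the duration of the current contract. *)
Definition algorithm := seq R -> seq nat -> nat.

Definition durations (A : algorithm) (xs : seq R) : seq nat :=
  foldl (fun ts i => rcons ts (A (take i.+1 xs) ts)) [::] (iota 0 (size xs)).

Definition under_contract (ts : seq nat) (s j : nat) : bool :=
  (j <= s < j + nth 0 ts j)%N.

Definition sequential (m : nat) (ts : seq nat) : Prop :=
  forall s, (s < m)%N -> exists! j, (j < m)%N && under_contract ts s j.

Definition online_sequential (m : nat) (A : algorithm) : Prop :=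
  (forall k (ts : seq nat),
     measurable_fun [set: k.-tuple R] (fun xs : k.-tuple R => A xs ts)) /\
  (forall xs : m.-tuple R, all (fun x => 0 <= x) xs ->
     sequential m (durations A xs)).

Definition cost (xs : seq R) (ts : seq nat) : R :=
  \sum_(i < size xs) xs`_i *+ nth 0%N ts i.

Definition expected_cost (mu : probability R R) m (A : algorithm) : \bar R :=
  'E_(iid mu m)[fun xs : m.-tuple R => cost xs (durations A xs)].

Definition min_cost (mu : probability R R) (m : nat) : \bar R :=
  ereal_inf [set expected_cost mu m A | A in online_sequential m].

Definition threshold (mu : probability R R) (m : nat) : \bar R :=
  if m is 0 then +oo%E else (min_cost mu m * (m%:R^-1)%:E)%E.

(* Once an earlier applicant passed the threshold test the algorithm has
   stopped, which amounts to choosing duration 0 from then on. *)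
Definition threshold_algorithm (mu : probability R R) (n : nat) : algorithm :=
  fun xs _ =>
    let i := (size xs).-1 in
    let accept j := ((xs`_j)%:E < threshold mu (n - j.+1))%E in
    if has accept (iota 0 i) then 0%N
    else if accept i then (n - i)%N
    else 1%N.

End hiring.

(* Main.v *)
Require Import Defs.
From HB Require Import structures.
From mathcomp Require Import all_boot all_order all_algebra.
From mathcomp Require Import all_classical all_reals all_analysis.
From mathcomp Require Import measurable_realfun.
From mathcomp Require Import zify lra.

(** Let [v 0 = 0] and [v (m + 1) = E (min ((m + 1) X) (X + v m))], the optimal
    cost when each applicant is hired either for one time step or for all the
    remaining ones.  Comparing the integrands pointwise shows by induction that
    [v m / m] is nonincreasing, so that hiring an applicant of cost [x] for [t]
    of the remaining [m + 1] steps, at cost [t x + v (m + 1 - t)], is never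
    better than one of the extreme choices [t = 1] and [t = m + 1].

    An arbitrary algorithm is bounded below by induction on the number [m] of
    applicants to come, the state being the number [c] of time steps already
    covered: conditioning on the first cost, its expected cost is at least
    [v (m - c)].  This needs no assumption on how later decisions depend on the
    costs seen while a contract is running.  The threshold algorithm picks the
    better of the two extreme choices, hence its cost satisfies the recursion
    of [v]. *)

Import Order.TTheory GRing.Theory Num.Theory.
Import numFieldNormedType.Exports.

Local Open Scope classical_set_scope.
Local Open Scope ring_scope.

Local Notation half_line := (`[0%R, +oo[%classic).

(** * Splitting off the first applicant *)

Section recursion.
Context {R : realType}.
Implicit Types (A : @algorithm R) (xs : seq R) (ts : seq nat).

Definition first_duration A (x : R) : nat := A [:: x] [::].

(** What remains of [A] once the first cost is fixed at [x]: a full algorithm for the later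
    applicants, which makes induction on their number possible. *)
Definition continuation A (x : R) : algorithm :=
  fun xs ts => A (x :: xs) (first_duration A x :: ts).

Lemma durations_cons A (x : R) xs :
  durations A (x :: xs) =
  first_duration A x :: durations (continuation A x) xs.
Proof.
rewrite /durations /= take0 -/(first_duration A x).
(* Generalizing the accumulator and the start index lets the first duration stay in front of every
   history while positions shift by one. *)
have E k i acc :
    foldl (fun ts i => rcons ts (A (take i.+1 (x :: xs)) ts))
      (first_duration A x :: acc) (iota i.+1 k) =
    first_duration A x ::
      foldl (fun ts i => rcons ts (continuation A x (take i.+1 xs) ts))
        acc (iota i k).
  by elim: k i acc => //= k IHk i acc; rewrite -rcons_cons IHk.
exact: E.
Qed.

Lemma size_durations A xs : size (durations A xs) = size xs.
Proof. by elim: xs A => // x xs IHxs A; rewrite durations_cons /= IHxs. Qed.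

Lemma cost_cons (x : R) xs (t : nat) ts :
  cost (x :: xs) (t :: ts) = x *+ t + cost xs ts.
Proof. by rewrite /cost /= big_ord_recl. Qed.

Lemma cost_ge0 xs ts : all (fun x => 0 <= x) xs -> 0 <= cost xs ts.
Proof.
move=> /allP xs0; rewrite /cost sumr_ge0 // => i _.
by rewrite mulrn_wge0 // xs0 // mem_nth.
Qed.

End recursion.

(** * Coverage of time steps as a counting condition *)

Definition load (ts : seq nat) (s : nat) : nat :=
  count (under_contract ts s) (iota 0 (size ts)).

(* [c] is the number of time steps, counted from now, that are still covered
   by a contract signed earlier. *)
Definition covers (c : nat) (ts : seq nat) : Prop :=
  forall s, (s < size ts)%N -> ((s < c) + load ts s = 1)%N.

Lemma load_cons0 (t : nat) (ts : seq nat) : load (t :: ts) 0 = (0 < t)%N.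
Proof.
rewrite /load /= -[RHS]addn0; congr addn.
apply/eqP; rewrite -leqn0 leqNgt -has_count; apply/hasPn => j.
by rewrite mem_iota /under_contract; case: j.
Qed.

Lemma load_consS (t : nat) (ts : seq nat) (s : nat) :
  load (t :: ts) s.+1 = ((s.+1 < t) + load ts s)%N.
Proof.
rewrite /load /=; congr addn; rewrite (iotaDl 1 0) count_map.
by apply: eq_count => j.
Qed.

(** Exactly one of [c] and [t] is positive, so [maxn c t] is the length of the contract in force,
    and its predecessor is what is left of it one step later. *)
Lemma covers_cons (c t : nat) (ts : seq nat) :
  covers c (t :: ts) <->
  ((0 < c) + (0 < t) = 1)%N /\ covers (maxn c t).-1 ts.
Proof.
split=> [ct|[ct0 ct] [|s] ss].
- have := ct 0%N (ltn0Sn _); rewrite load_cons0 => ct0; split=> // s ss.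
  have := ct s.+1 ss; rewrite load_consS; lia.
- by rewrite load_cons0.
- by have := ct s ss; rewrite load_consS; lia.
Qed.

Lemma sequential_covers (ts : seq nat) :
  sequential (size ts) ts <-> covers 0 ts.
Proof.
have E s : (exists! j, (j < size ts)%N && under_contract ts s j) <->
    load ts s = 1%N.
  rewrite /load -size_filter; split=> [[j [/andP[js jc]] ju]|].
    have -> : [seq i <- iota 0 (size ts) | under_contract ts s i] = [:: j].
      apply: (@irr_sorted_eq _ ltn) => //.
      - exact: ltn_trans.
      - exact: ltnn.
      - by rewrite sorted_filter ?iota_ltn_sorted //; exact: ltn_trans.
      move=> i; rewrite mem_filter mem_iota add0n inE /= andbC.
      by apply/idP/eqP => [/ju ->|->] //; rewrite js.
    by [].
  case E: [seq _ <- _ | _] => [|j [|? ?]] //= _.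
  have M i : (i < size ts)%N && under_contract ts s i = (i == j).
    have := mem_filter (under_contract ts s) i (iota 0 (size ts)).
    by rewrite E inE mem_iota add0n andbC.
  by exists j; split=> [|i]; rewrite M ?eqxx // => /eqP ->.
split=> h s ss; last by apply/E; have := h s ss; rewrite ltn0.
by rewrite ltn0; apply/E; exact: h.
Qed.

(** * Measurability of durations and cost *)

Lemma measurable_fun_countable_family (d1 d2 : measure_display)
    (T1 : measurableType d1) (T2 : measurableType d2) (I : countType)
    (i : T1 -> I) (F : I -> T1 -> T2) :
  (forall j, measurable (i @^-1` [set j])) ->
  (forall j, measurable_fun [set: T1] (F j)) ->
  measurable_fun [set: T1] (fun x => F (i x) x).
Proof.
move=> mi mF _ Y mY; rewrite setTI.
rewrite (_ : _ @^-1` _ = \bigcup_j (i @^-1` [set j] `&` F j @^-1` Y)).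
  apply: countable_bigcupT_measurable => [|j]; first exact: countableP.
  apply: measurableI => //.
  by rewrite -[X in measurable X]setTI; exact: mF.
by apply/seteqP; split=> [x Yx|x [j _ [/= <-]]] //; exists (i x).
Qed.

Section measurability.
Context {R : realType}.
Implicit Type A : @algorithm R.

Definition measurable_algorithm A : Prop := forall k (ts : seq nat),
  measurable_fun [set: k.-tuple R] (fun xs : k.-tuple R => A xs ts).

Lemma measurable_take k (m : nat) :
  measurable_fun [set: m.-tuple R] (fun xs => [tuple of take k xs]).
Proof.
apply/measurable_fun_tnthP => i.
have im : (i < m)%N by rewrite (leq_trans (ltn_ord i)) // geq_minr.
rewrite (_ : _ \o _ = (@tnth _ R ^~ (Ordinal im))); first exact: measurable_tnth.
apply/funext => xs /=; rewrite !(tnth_nth 0) /= nth_take //.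
by rewrite (leq_trans (ltn_ord i)) // geq_minl.
Qed.

Lemma measurable_cons_tuple (x : R) (m : nat) :
  measurable_fun [set: m.-tuple R] (fun xs => [tuple of x :: xs]).
Proof. exact: measurable_cons. Qed.

Lemma measurable_algorithm_continuation A (x : R) :
  measurable_algorithm A -> measurable_algorithm (continuation A x).
Proof.
move=> mA k ts.
exact: (measurableT_comp (mA k.+1 (first_duration A x :: ts))
                         (@measurable_cons_tuple x k)).
Qed.

(** Induction on the number [k] of decisions made: the history is [rcons us t] exactly when the
    earlier history is [us] and [A], fed with this fixed [us], answers [t]. *)
Lemma measurable_durations A (m : nat) (ts : seq nat) :
  measurable_algorithm A ->
  measurable [set xs : m.-tuple R | durations A xs = ts].
Proof.
move=> mA.
pose D k (xs : m.-tuple R) :=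
  foldl (fun ts i => rcons ts (A (take i.+1 xs) ts)) [::] (iota 0 k).
have DS k xs : D k.+1 xs = rcons (D k xs) (A (take k.+1 xs) (D k xs)).
  by rewrite /D -[in LHS]addn1 iotaD foldl_cat.
rewrite (_ : [set _ | _] = [set xs | D m xs = ts]); last first.
  by apply/seteqP; split=> xs /=; rewrite /durations size_tuple.
suff mD k us : measurable [set xs | D k xs = us] by exact: mD.
elim: k us => [|k IHk] {}ts.
  have [<-|ts0] := eqVneq [::] ts.
    by rewrite (_ : [set _ | _] = setT) //; apply/seteqP; split.
  rewrite (_ : [set _ | _] = set0) //; apply/seteqP; split => // xs /= /eqP.
  by rewrite (negbTE ts0).
case: (lastP ts) => [|us t].
  rewrite (_ : [set _ | _] = set0) //; apply/seteqP; split => // xs /=.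
  by rewrite DS; case: (D k xs).
rewrite (_ : [set _ | _] = [set xs | D k xs = us] `&`
    [set xs : m.-tuple R | A (take k.+1 xs) us = t]).
  apply: measurableI => //.
  have := measurableT_comp (mA _ us) (@measurable_take k.+1 m).
  by move=> /(_ measurableT [set t] I); rewrite setTI.
apply/seteqP; split=> xs /=; rewrite DS.
  by move=> /rcons_inj[-> ->].
by move=> [-> ->].
Qed.

(** There are countably many duration sequences, and for each fixed one the cost is linear in the
    entries of the tuple. *)
Lemma measurable_cost A (m : nat) : measurable_algorithm A ->
  measurable_fun [set: m.-tuple R]
    (fun xs : m.-tuple R => cost xs (durations A xs)).
Proof.
move=> mA; apply: (@measurable_fun_countable_family _ _ _ _ _
  (fun xs : m.-tuple R => durations A xs)
  (fun ts (xs : m.-tuple R) => cost xs ts)) => ts.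
  exact: measurable_durations.
rewrite (_ : (fun _ => _) = fun xs => \sum_(i < m) tnth xs i *+ nth 0%N ts i).
  apply: measurable_sum => i.
  exact: (measurableT_comp (natmul_measurable _) (@measurable_tnth _ R m i)).
apply/funext => xs; under [RHS]eq_bigr do rewrite (tnth_nth 0).
by rewrite /cost -(big_mkord xpredT (fun i => xs`_i *+ nth 0%N ts i)) size_tuple
  big_mkord.
Qed.

End measurability.

(** * Independent nonnegative draws and Tonelli *)

Section nonneg_iid.
Context {R : realType} (mu : probability R R).
Hypothesis mu_ge0 : mu half_line = 1%E.

Definition nonneg_tuple m : set (m.-tuple R) :=
  [set xs | all (fun x => 0 <= x) xs].

Lemma measurable_nonneg_tuple m : measurable (nonneg_tuple m).
Proof.
rewrite (_ : nonneg_tuple m =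
    \bigcap_(i in [set: 'I_m]) ((@tnth _ R ^~ i) @^-1` half_line)).
  apply: fin_bigcap_measurable => // i _.
  by rewrite -[X in measurable X]setTI; exact: measurable_tnth.
apply/seteqP; split=> xs /=.
  by move=> /all_tnthP xs0 i _ /=; rewrite in_itv /= andbT.
by move=> xs0; apply/all_tnthP => i; have := xs0 i I; rewrite /= in_itv /= andbT.
Qed.

Lemma iid_nonneg_tuple m : iid mu m (nonneg_tuple m) = 1%E.
Proof.
elim: m => [|m IHm] /=; first by rewrite diracE mem_set.
rewrite /distribution /pushforward.
rewrite (_ : _ @^-1` _ = half_line `*` nonneg_tuple m).
  rewrite product_measure1E //; last exact: measurable_nonneg_tuple.
  by have := congr2 mule mu_ge0 IHm; rewrite mul1e.
by apply/seteqP; split=> -[x xs]; rewrite /nonneg_tuple /= in_itv /= andbT => /andP.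
Qed.

Lemma integral_nonneg_tuple m (f : m.-tuple R -> \bar R) :
  measurable_fun [set: m.-tuple R] f ->
  (\int[iid mu m]_xs f xs = \int[iid mu m]_(xs in nonneg_tuple m) f xs)%E.
Proof.
move=> mf; rewrite [RHS]integral_mkcond; apply: ae_eq_integral => //.
  apply/measurable_restrict => //; first exact: (measurable_nonneg_tuple m).
  by rewrite setTI; exact: measurable_funTS.
exists (~` nonneg_tuple m); split.
- by apply: measurableC; exact: measurable_nonneg_tuple.
- have := probability_setC (iid mu m) (measurable_nonneg_tuple m).
  by rewrite iid_nonneg_tuple subee.
- move=> xs /= nE xs0; apply: nE => _.
  by rewrite patchE mem_set.
Qed.

Section tonelli.
Context (m : nat) (f : m.+1.-tuple R -> \bar R).
Hypotheses (mf : measurable_fun [set: m.+1.-tuple R] f)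
  (f_ge0 : forall xs, nonneg_tuple m.+1 xs -> (0 <= f xs)%E).

(** Extending [f] by zero off the nonnegative tuples gives the global nonnegativity that Tonelli
    asks for. *)
Let g := f \_ (nonneg_tuple m.+1) \o @pair_cons R m.

Let mg : measurable_fun setT g.
Proof.
apply: measurableT_comp => //; apply/measurable_restrict => //.
  exact: measurable_nonneg_tuple.
by rewrite setTI; exact: measurable_funTS.
Qed.

Let g_ge0 p : (0 <= g p)%E.
Proof. by rewrite /g /= patchE; case: ifPn => // /set_mem; exact: f_ge0. Qed.

(** No tuple starting with a negative [x] is nonnegative, so the inner integral vanishes there and
    the outer one lives on the half line. *)
Let gE : fubini_F (iid mu m) g = (fun x : R =>
  \int[iid mu m]_(xs in nonneg_tuple m) f [tuple of x :: xs])%E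
    \_ half_line.
Proof.
apply/funext => x; rewrite /fubini_F patchE; case: ifPn => [/set_mem|] /=.
  rewrite in_itv /= andbT => x0; rewrite [RHS]integral_mkcond.
  apply: eq_integral => xs _; rewrite /g /= !patchE; congr (if _ then _ else _).
  by rewrite /nonneg_tuple /=; apply/asboolP/asboolP; rewrite /= x0.
rewrite notin_setE /= in_itv /= andbT => /negP x0.
apply: integral0_eq => xs _; rewrite /g /= patchE memNset //.
by rewrite /nonneg_tuple /= (negbTE x0).
Qed.

Lemma measurable_iid_tonelli : measurable_fun (half_line : set R) (fun x : R =>
  \int[iid mu m]_(xs in nonneg_tuple m) f [tuple of x :: xs])%E.
Proof.
rewrite -[X in measurable_fun X]setTI; apply/measurable_restrict => //.
by rewrite -gE; exact: measurable_fun_fubini_tonelli_F.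
Qed.

Lemma iid_tonelli :
  (\int[iid mu m.+1]_(xs in nonneg_tuple m.+1) f xs =
   \int[mu]_(x in half_line)
     \int[iid mu m]_(xs in nonneg_tuple m) f [tuple of x :: xs])%E.
Proof.
rewrite integral_mkcond [RHS]integral_mkcond -gE -fubini_tonelli1 //=.
rewrite ge0_integral_pushforward //.
- apply/measurable_restrict => //; first exact: measurable_nonneg_tuple.
  by rewrite setTI; exact: measurable_funTS.
- by move=> xs _; rewrite patchE; case: ifPn => // /set_mem; exact: f_ge0.
Qed.

End tonelli.
End nonneg_iid.

(** * The optimal value recursion and its ratio monotonicity *)

Section value.
Context {R : realType} (mu : probability R R).
Hypothesis mu_ge0 : mu half_line = 1%E.
Hypothesis mu_mean : (\int[mu]_(x in half_line) x%:E < +oo)%E.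

Fixpoint value (m : nat) : R :=
  if m is k.+1 then
    \int[mu]_(x in half_line) Num.min (x *+ k.+1) (x + value k)
  else 0.

Definition step_cost (m : nat) (x : R) : R :=
  Num.min (x *+ m.+1) (x + value m).

Lemma value_ge0 (m : nat) : 0 <= value m.
Proof.
elim: m => //= m IHm; apply: Rintegral_ge0 => x /=.
by rewrite in_itv /= andbT => x0; rewrite le_min mulrn_wge0 ?addr_ge0.
Qed.

Lemma step_cost_ge0 (m : nat) (x : R) : 0 <= x -> 0 <= step_cost m x.
Proof. by move=> x0; rewrite le_min mulrn_wge0 ?addr_ge0 ?value_ge0. Qed.

Lemma measurable_step_cost (m : nat) : measurable_fun setT (step_cost m).
Proof.
apply: measurable_minr; first exact: natmul_measurable.
exact: measurable_funD.
Qed.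

Lemma integrable_step_cost (m : nat) :
  mu.-integrable half_line (EFin \o step_cost m).
Proof.
have ix : mu.-integrable half_line (EFin \o id).
  apply/integrableP; split.
    by apply/measurable_EFinP; exact: measurable_id.
  apply: le_lt_trans mu_mean; rewrite le_eqVlt; apply/orP; left; apply/eqP.
  apply: eq_integral => x; rewrite inE /= in_itv /= andbT => x0.
  by rewrite ger0_norm.
apply: (@le_integrable _ _ _ _ _ _ _
    ((EFin \o @id R) \+ (EFin \o @cst R R (value m)))%E) => //.
- by apply/measurable_EFinP; apply: measurable_funTS; exact: measurable_step_cost.
- move=> x /=; rewrite in_itv /= andbT => x0.
  rewrite lee_fin !ger0_norm ?step_cost_ge0 ?addr_ge0 ?value_ge0 //.
  by rewrite /step_cost /= ge_min lexx orbT.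
- by apply: integrableD => //; exact: finite_measure_integrable_cst.
Qed.

(** [value] uses the real-valued integral; the finite mean makes the integrand integrable, so taking
    the real part loses nothing. *)
Lemma integral_step_cost (m : nat) :
  (\int[mu]_(x in half_line) (step_cost m x)%:E = (value m.+1)%:E)%E.
Proof. by rewrite /= fineK // integrable_fin_num //; exact: integrable_step_cost. Qed.

Lemma value_ratioS (k : nat) : k%:R * value k.+1 <= k.+1%:R * value k.
Proof.
elim: k => [|k IHk]; first by rewrite mul0r mulr0.
rewrite [value k.+2]/= [in leRHS]/= -!RintegralZl //;
  [|exact: integrable_step_cost..].
apply: le_Rintegral => //.
- exact: (integrableZl _ k.+1%:R (integrable_step_cost k.+1)).
- exact: (integrableZl _ k.+2%:R (integrable_step_cost k)).
move=> x /=; rewrite in_itv /= andbT => x0.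
rewrite [leRHS]minr_pMr // le_min.
set w := Num.min _ _.
have w1 : w <= k.+2%:R * x by rewrite /w ge_min mulr_natl lexx.
have w2 : w <= x + value k.+1 by rewrite /w ge_min lexx orbT.
apply/andP; split; first by rewrite -(mulr_natl x) mulrCA ler_wpM2l.
(* After multiplication by [k + 1] the left side holds [(k + 1)^2 = 1 + k (k + 2)] copies of [w].
   Bounding one copy by [w1] and the others by [w2] leaves [k (k + 2) v'], which the induction
   hypothesis bounds by [(k + 2) (k + 1) v]. *)
have a0 : 0 < k.+1%:R :> R by rewrite ltr0n.
rewrite -(ler_pM2l a0).
have k0 : 0 <= k%:R :> R by rewrite ler0n.
move: w1 w2 IHk a0 k0; rewrite -!natr1; move: (k%:R) (value _) (value _) => a v v'.
nra.
Qed.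

Lemma value_ratio (i j : nat) : (i <= j)%N ->
  i%:R * value j <= j%:R * value i.
Proof.
elim: j => [|j IHj]; first by rewrite leqn0 => /eqP ->.
rewrite leq_eqVlt ltnS => /predU1P[-> //|ij].
have [j0|j0] := posnP j.
  by move: ij; rewrite j0 leqn0 => /eqP -> /=; rewrite mul0r mulr0.
have {}j0 : 0 < j%:R :> R by rewrite ltr0n.
rewrite -(ler_pM2l j0) mulrCA.
apply: (@le_trans _ _ (i%:R * (j.+1%:R * value j))).
  by rewrite ler_wpM2l // value_ratioS.
by rewrite mulrCA [leRHS]mulrCA ler_wpM2l // IHj.
Qed.

(* By [value_ratio] the right-hand side dominates an affine function of [t] on
   [1, m.+1], whose endpoint values are the two arguments of the minimum. *)
Lemma step_cost_le (m t : nat) (x : R) : 0 <= x -> (0 < t)%N ->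
  step_cost m x <= x *+ t + value (m - t.-1).
Proof.
move=> x0 t0; rewrite /step_cost ge_min.
(* For [t > m] the contract alone already costs at least [(m + 1) x]. *)
have [mt|tm] := ltnP m t.
  by rewrite ler_wpDr ?value_ge0 // ler_wpMn2l.
have km : (m - t.-1 <= m)%N by rewrite leq_subr.
set k := (m - t.-1)%N in km *.
have tk : (k + t = m.+1)%N by rewrite /k; lia.
have m0 : 0 < m%:R :> R by rewrite ltr0n; lia.
have kmR : k%:R <= m%:R :> R by rewrite ler_nat.
have := value_ratio _ _ km.
have tR : t%:R = m%:R + 1 - k%:R :> R by rewrite natr1 -tk natrD addrAC subrr add0r.
rewrite -!(mulr_natl x) tR -natr1.
move: (value m) (value k) => v v'.
(* The sign of [v - m x] tells which endpoint is cheaper. Scaling this comparison by [k],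
   respectively by [m - k], and adding [k v <= m v'] gives the bound. *)
move=> h; apply/orP; have [vm|vm] := leP (m%:R * x) v.
  left; rewrite -(ler_pM2l m0).
  by have := ler_wpM2l (ler0n R k) vm; lra.
right; rewrite -(ler_pM2l m0).
rewrite -subr_ge0 in kmR.
by have := ler_wpM2l kmR (ltW vm); lra.
Qed.

End value.

(** * Lower bound for arbitrary algorithms *)

Section lower_bound.
Context {R : realType} (mu : probability R R).
Hypothesis mu_ge0 : mu half_line = 1%E.
Hypothesis mu_mean : (\int[mu]_(x in half_line) x%:E < +oo)%E.
Implicit Type A : @algorithm R.

(** The domain is restricted because only there are the costs nonnegative and is the algorithm bound
    to cover each step once. *)
Definition nonneg_cost m A : \bar R :=
  (\int[iid mu m]_(xs in nonneg_tuple m) (cost xs (durations A xs))%:E)%E.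

Lemma expected_cost_nonneg m A : measurable_algorithm A ->
  expected_cost mu m A = nonneg_cost m A.
Proof.
move=> mA; rewrite /expected_cost unlock integral_nonneg_tuple //.
by apply/measurable_EFinP; exact: measurable_cost.
Qed.

Lemma nonneg_cost_cons m A (x : R) : measurable_algorithm A -> 0 <= x ->
  (\int[iid mu m]_(xs in nonneg_tuple m)
     (cost [tuple of x :: xs] (durations A [tuple of x :: xs]))%:E =
   (x *+ first_duration A x)%:E + nonneg_cost m (continuation A x))%E.
Proof.
move=> mA x0; have mN := @measurable_nonneg_tuple R m.
under eq_integral do rewrite /= durations_cons cost_cons EFinD.
rewrite ge0_integralD //.
- by rewrite integral_cst // [X in (_ * X)%E]iid_nonneg_tuple // mule1.
- by move=> xs _; rewrite lee_fin mulrn_wge0.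
- by move=> xs xs0; rewrite lee_fin cost_ge0.
- apply: measurable_funTS; apply/measurable_EFinP.
  by apply: measurable_cost; exact: measurable_algorithm_continuation.
Qed.

Lemma measurable_nonneg_costS m A : measurable_algorithm A ->
  measurable_fun (half_line : set R) (fun x =>
    ((x *+ first_duration A x)%:E + nonneg_cost m (continuation A x))%E).
Proof.
move=> mA; apply: (eq_measurable_fun (fun x =>
  \int[iid mu m]_(xs in nonneg_tuple m)
     (cost [tuple of x :: xs] (durations A [tuple of x :: xs]))%:E)%E).
  move=> x; rewrite inE /= in_itv /= andbT => x0.
  exact: nonneg_cost_cons.
apply: (@measurable_iid_tonelli _ mu m
  (fun xs => (cost xs (durations A xs))%:E)).
  by apply/measurable_EFinP; exact: measurable_cost.
by move=> xs xs0; rewrite lee_fin cost_ge0.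
Qed.

Lemma nonneg_costS m A : measurable_algorithm A ->
  nonneg_cost m.+1 A =
  (\int[mu]_(x in half_line)
    ((x *+ first_duration A x)%:E + nonneg_cost m (continuation A x)))%E.
Proof.
move=> mA; rewrite /nonneg_cost iid_tonelli.
- apply: eq_integral => x; rewrite inE /= in_itv /= andbT => x0.
  exact: nonneg_cost_cons.
- by apply/measurable_EFinP; exact: measurable_cost.
- by move=> xs xs0; rewrite lee_fin cost_ge0.
Qed.

Lemma value_le_nonneg_cost m (c : nat) A : measurable_algorithm A ->
  (forall xs : m.-tuple R, nonneg_tuple m xs -> covers c (durations A xs)) ->
  ((value mu (m - c))%:E <= nonneg_cost m A)%E.
Proof.
elim: m c A => [|m IHm] c A mA cA.
  by apply: integral_ge0 => xs xs0; rewrite lee_fin cost_ge0.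
pose t := first_duration A.
have cons_cA (x : R) (xs : m.-tuple R) : 0 <= x -> nonneg_tuple m xs ->
    ((0 < c) + (0 < t x) = 1)%N /\
    covers (maxn c (t x)).-1 (durations (continuation A x) xs).
  move=> x0 xs0; apply/covers_cons; rewrite -durations_cons.
  by apply: (cA [tuple of x :: xs]); rewrite /nonneg_tuple /= x0.
(* This constraint involves no later cost, so any nonnegative tuple exhibits it; the zero tuple is
   used. *)
have ct (x : R) : 0 <= x -> ((0 < c) + (0 < t x) = 1)%N.
  move=> x0; apply: (proj1 (cons_cA x [tuple of nseq m 0] x0 _)).
  by rewrite /nonneg_tuple /=; apply/allP => y /nseqP[->].
have IH (x : R) : 0 <= x ->
    ((value mu (m - (maxn c (t x)).-1))%:E <= nonneg_cost m (continuation A x))%E.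
  move=> x0; apply: IHm; first exact: measurable_algorithm_continuation.
  by move=> xs xs0; have [] := cons_cA x xs x0 xs0.
rewrite nonneg_costS //.
case: c cA cons_cA ct IH => [|c] _ _ ct IH.
  (* With no step covered, the first applicant must be hired, and [step_cost_le] bounds the contract
     plus the value of what follows. *)
  rewrite subn0 -integral_step_cost //.
  apply: ge0_le_integral => //.
  - move=> x /=; rewrite in_itv /= andbT => x0.
    by rewrite lee_fin step_cost_ge0.
  - by apply/measurable_EFinP; apply: measurable_funTS; exact: measurable_step_cost.
  - exact: measurable_nonneg_costS.
  move=> x /=; rewrite in_itv /= andbT => x0.
  have t0 : (0 < t x)%N by have := ct x x0; case: (t x).
  have := IH x x0; rewrite max0n => /(leeD2l (x *+ t x)%:E).
  by apply: le_trans; rewrite -EFinD lee_fin step_cost_le.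
(* With the current step covered, the duration is forced to be [0]: nothing is paid, and the bound
   is the same constant for every [x]. *)
have -> : ((value mu (m.+1 - c.+1))%:E =
    \int[mu]_(x in half_line) (value mu (m - c))%:E)%E.
  by rewrite integral_cst // [X in (_ * X)%E]mu_ge0 mule1 subSS.
apply: ge0_le_integral => //.
- by move=> x _; rewrite lee_fin value_ge0.
- exact: measurable_nonneg_costS.
move=> x /=; rewrite in_itv /= andbT => x0.
have t0 : t x = 0%N by have := ct x x0; case: (t x).
by have := IH x x0; rewrite -/(t x) t0 maxn0 /= add0e.
Qed.

End lower_bound.

(** Decisions are only ever queried on nonempty prefixes. The restriction matters for threshold
    algorithms, whose answer on the empty sequence comes from default values. *)
Lemma eq_durations (R : realType) (A B : @algorithm R) (xs : seq R) :
  (forall ys ts, (0 < size ys)%N -> A ys ts = B ys ts) ->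
  durations A xs = durations B xs.
Proof.
elim: xs A B => // x xs IHxs A B AB; rewrite !durations_cons.
rewrite /first_duration AB //; congr cons; apply: IHxs => ys ts ys0.
by rewrite /continuation /first_duration !AB.
Qed.

Lemma cost_nseq0 (R : realType) (xs : seq R) (k : nat) :
  cost xs (nseq k 0%N) = 0.
Proof. by rewrite /cost big1 // => i _; rewrite nth_nseq if_same mulr0n. Qed.

Lemma durations_cst0 (R : realType) (xs : seq R) :
  durations (fun _ _ => 0%N) xs = nseq (size xs) 0%N.
Proof. by elim: xs => // x xs IHxs; rewrite durations_cons /= -IHxs. Qed.

Lemma covers_nseq0 (c k : nat) : (k <= c)%N -> covers c (nseq k 0%N).
Proof.
elim: k c => // k IHk [//|c] kc.
by apply/covers_cons; rewrite maxn0; split=> //; exact: IHk.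
Qed.

(** * The threshold algorithm and its optimality *)

Section threshold.
Context {R : realType} (mu : probability R R).

Lemma first_duration_threshold (n : nat) (x : R) :
  first_duration (threshold_algorithm mu n.+1) x =
  if (x%:E < threshold mu n)%E then n.+1 else 1%N.
Proof. by rewrite /first_duration /threshold_algorithm /= subSS !subn0. Qed.

(** Thresholds depend only on the number of applicants still to come, so dropping a rejected first
    applicant turns the algorithm for [n.+1] into the one for [n]. An accepted one makes the
    stopping test succeed ever after. *)
Lemma continuation_threshold (n : nat) (x : R) (xs : seq R) :
  durations (continuation (threshold_algorithm mu n.+1) x) xs =
  if (x%:E < threshold mu n)%E then nseq (size xs) 0%N
  else durations (threshold_algorithm mu n) xs.
Proof.
have E (y : R) ys ts :
    continuation (threshold_algorithm mu n.+1) x (y :: ys) ts =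
    if (x%:E < threshold mu n)%E then 0%N
    else threshold_algorithm mu n (y :: ys) ts.
  rewrite /continuation /threshold_algorithm /= subSS subn0.
  case: (_ < _)%E => //=.
  by rewrite (iotaDl 1 0) has_map /=.
case: ifPn => xn; rewrite -?durations_cst0; apply: eq_durations => -[//|y ys] ts _.
  by rewrite E xn.
by rewrite E (negbTE xn).
Qed.

Lemma covers_threshold (xs : seq R) :
  covers 0 (durations (threshold_algorithm mu (size xs)) xs).
Proof.
elim: xs => // x xs IHxs; rewrite durations_cons; apply/covers_cons.
rewrite first_duration_threshold continuation_threshold.
by case: ifPn => _; split=> //; rewrite max0n; exact: covers_nseq0.
Qed.

Lemma measurable_threshold_algorithm (n : nat) :
  measurable_algorithm (threshold_algorithm mu n).
Proof.
move=> k ts; rewrite /threshold_algorithm.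
have mnth j : measurable_fun [set: k.-tuple R] (fun xs : k.-tuple R => xs`_j).
  have [jk|kj] := ltnP j k.
    rewrite (_ : (fun _ => _) = @tnth _ R ^~ (Ordinal jk)).
      exact: measurable_tnth.
    by apply/funext => xs; rewrite (tnth_nth 0).
  rewrite (_ : (fun _ => _) = cst 0) //.
  by apply/funext => xs; rewrite nth_default // size_tuple.
have macc j : measurable_fun [set: k.-tuple R]
    (fun xs : k.-tuple R => ((xs`_j)%:E < threshold mu (n - j.+1))%E).
  by apply: measurable_fun_lte => //; apply/measurable_EFinP.
rewrite (_ : (fun _ => _) = fun xs : k.-tuple R =>
    if has (fun j => (xs`_j)%:E < threshold mu (n - j.+1))%E (iota 0 k.-1)
    then 0%N
    else if ((xs`_k.-1)%:E < threshold mu (n - k.-1.+1))%E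
    then (n - k.-1)%N else 1%N); last first.
  by apply/funext => xs; rewrite size_tuple.
apply: measurable_fun_ifT => //; last exact: measurable_fun_ifT.
elim: (iota _ _) => [|j s IHs] //=.
exact: measurable_or.
Qed.

Lemma online_sequential_threshold (n : nat) :
  online_sequential n (threshold_algorithm mu n).
Proof.
split=> [|xs _]; first exact: measurable_threshold_algorithm.
rewrite -{1}(size_tuple xs) -(size_durations (threshold_algorithm mu n)).
by apply/sequential_covers; rewrite -[in threshold_algorithm _ _](size_tuple xs);
  exact: covers_threshold.
Qed.

Hypothesis mu_ge0 : mu half_line = 1%E.
Hypothesis mu_mean : (\int[mu]_(x in half_line) x%:E < +oo)%E.

(** The thresholds are built from [min_cost] at smaller sizes. Assuming its value only there keeps
    the lemma usable inside the strong induction that computes [min_cost]. *)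
Lemma nonneg_cost_threshold (n : nat) :
  (forall k, (k < n)%N -> min_cost mu k = (value mu k)%:E) ->
  nonneg_cost mu n (threshold_algorithm mu n) = (value mu n)%:E.
Proof.
elim: n => [|n IHn] min_costE.
  by apply: integral0_eq => xs _; rewrite tuple0 /cost big_ord0.
rewrite nonneg_costS //; last exact: measurable_threshold_algorithm.
rewrite -integral_step_cost //.
apply: eq_integral => x; rewrite inE /= in_itv /= andbT => x0.
(* Adding [x] to both sides of the last inequality compares the two arguments of [step_cost]; the
   disjunct [n == 0] is the infinite threshold of the last applicant. *)
have lt_thresholdE : (x%:E < threshold mu n)%E = (n == 0%N) || (x *+ n < value mu n).
  case: n {IHn} min_costE => [|n] min_costE /=; first by rewrite ltry.
  by rewrite min_costE // -EFinM lte_fin ltr_pdivlMr ?ltr0n // mulr_natr.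
rewrite first_duration_threshold /nonneg_cost.
under eq_integral do rewrite continuation_threshold.
case: ifPn; rewrite lt_thresholdE.
  move=> nx; under eq_integral do rewrite cost_nseq0.
  rewrite integral0 adde0; congr EFin; apply/esym/min_idPl.
  rewrite mulrS lerD2l; case/orP: nx => [/eqP ->|/ltW //]; exact: value_ge0.
rewrite negb_or -leNgt => /andP[_ nx].
rewrite -[X in (_ + X)%E]/(nonneg_cost mu n (threshold_algorithm mu n)).
rewrite IHn => [|k kn]; last by rewrite min_costE // ltnW.
by rewrite -EFinD; congr EFin; apply/esym/min_idPr; rewrite mulrS lerD2l.
Qed.

(** Strong induction: smaller sizes fix the thresholds, so the threshold algorithm attains
    [value mu n]; the lower bound is the case of no step covered in advance. *)
Lemma min_cost_value (n : nat) : min_cost mu n = (value mu n)%:E.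
Proof.
elim/ltn_ind: n => n IHn; apply/eqP; rewrite eq_le; apply/andP; split.
  apply: ereal_inf_lbound; exists (threshold_algorithm mu n).
    exact: online_sequential_threshold.
  rewrite expected_cost_nonneg //; last exact: measurable_threshold_algorithm.
  exact: nonneg_cost_threshold.
apply: le_ereal_inf_tmp => _ [A [mA sA] <-].
rewrite expected_cost_nonneg // -[in value _ _](subn0 n).
apply: value_le_nonneg_cost => // xs xs0; apply/sequential_covers.
by rewrite size_durations size_tuple; exact: sA.
Qed.

End threshold.

(** * Transfer to the law of a random variable *)

Lemma integral_distribution_nonneg (R : realType) (d : measure_display)
    (T : measurableType d) (P : probability T R) (X : {RV P >-> R}) :
  distribution P X half_line = 1%E ->
  (\int[distribution P X]_(x in half_line) x%:E = 'E_P[X])%E.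
Proof.
move=> X_ge0; have mX : measurable (X @^-1` half_line).
  by rewrite -[X in measurable X]setTI; exact: measurable_funPT.
rewrite ge0_integral_pushforward //.
- rewrite expectation_def integral_mkcond; apply: ae_eq_integral => //.
  + apply/measurable_restrict => //; rewrite setTI; apply: measurable_funTS.
    exact/measurable_EFinP.
  + exact/measurable_EFinP.
  (* The two integrands differ only where [X] is negative, a null event by [X_ge0]. *)
  exists (~` (X @^-1` half_line)); split; first exact: measurableC.
    by have := probability_setC P mX; rewrite [P (X @^-1` _)]X_ge0 subee.
  move=> w /= nE Xw; apply: nE => _.
  by rewrite patchE mem_set.
- by move=> x; rewrite inE /= in_itv /= andbT lee_fin.
Qed.

Theorem theorem7p4 (R : realType) (d : measure_display) (T : measurableType d)
    (P : probability T R) (X : {RV P >-> R})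
    (X_continuous : continuous (cdf X))
    (X_ge0 : distribution P X `[0, +oo[ = 1%E)
    (X_mean : ('E_P[X] < +oo)%E)
    (n : nat) :
  online_sequential n (threshold_algorithm (distribution P X) n) /\
  expected_cost (distribution P X) n (threshold_algorithm (distribution P X) n)
    = min_cost (distribution P X) n.
Proof.
rewrite -(integral_distribution_nonneg _ _ _ _ _ X_ge0) in X_mean.
split; first exact: online_sequential_threshold.
rewrite min_cost_value // expected_cost_nonneg //; last first.
  exact: measurable_threshold_algorithm.
by apply: nonneg_cost_threshold => // k _; exact: min_cost_value.
Qed.
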